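(* A metric segment in a proper class endowed with a distance function can itself be a proper class. As an example, consider the class $\mathcal{GH}$ of all metric spaces considered up to isometry, with the Gromov--Hausdorff distance $d_{GH}$, and the metric segment $[\Delta_1,\Delta_n]$ in it, where $\Delta_n$ stands for the metric space of cardinality $n$ all of whose non-zero distances are equal to $1$ (so $\Delta_1$ is the single-point space). The curve $\gamma(t)$, $t\in[0,1]$, with $\gamma(0)=\Delta_1$ and $\gamma(t)=t\,\Delta_n$ for all other $t$, is a shortest curve connecting $\Delta_1$ and $\Delta_n$. Let $Z=\frac12\Delta_n$, choose an arbitrary point $z\in Z$ and replace it with a non-empty set $A$ of arbitrary cardinality; fix a positive $\varepsilon<1/2$, and on $Z'=(Z\setminus\{z\})\sqcup A$ put $|aa'|=\varepsilon$ and $|az'|=|zz'|=1/2$ for any distinct $a,a'\in A$ and any $z'\in Z\setminus\{z\}$ (the distances between points of $Z\setminus\{z\}$ being kept). Then $d_{GH}(Z',\Delta_1)=d_{GH}(Z,\Delta_1)$ and $d_{GH}(Z',\Delta_n)=d_{GH}(Z,\Delta_n)$, therefore any such space $Z'$ belongs to $[\Delta_1,\Delta_n]$. Since the cardinality of $Z'$ is arbitrary, $[\Delta_1,\Delta_n]$ is a proper class.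
   Context: All metric spaces are non-empty, with finite distances; $|xy|$ denotes the distance between points $x,y$, and $\lambda X$ denotes the space $X$ with all distances multiplied by $\lambda>0$. $d_{GH}$ is the Gromov--Hausdorff distance, $d_{GH}(X,Y)=\frac12\inf\operatorname{dis}R$ over all correspondences $R\subset X\times Y$ (subsets projecting surjectively onto both factors), where $\operatorname{dis}R=\sup\{\bigl||xx'|-|yy'|\bigr|:(x,y),(x',y')\in R\}$. The metric segment $[X,Y]$ (defined when $d_{GH}(X,Y)<\infty$) is the class of all $W\in\mathcal{GH}$ lying between $X$ and $Y$, i.e. with $d_{GH}(X,W)+d_{GH}(W,Y)=d_{GH}(X,Y)$. A shortest curve is a continuous curve whose length equals the distance between its endpoints. The ambient set theory is von Neumann--Bernays--Gödel (NBG), in which classes are either sets or proper classes; metric spaces are identified with their isometry classes. *)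

(* Defs.v *)
From HB Require Import structures.
From mathcomp Require Import all_boot all_order all_algebra.
From mathcomp Require Import all_classical all_reals all_analysis.
From mathcomp Require Import lra.

Set Implicit Arguments.
Unset Strict Implicit.
Unset Printing Implicit Defensive.

Import Order.TTheory GRing.Theory Num.Theory.
Import numFieldNormedType.Exports.

Local Open Scope classical_set_scope.
Local Open Scope ring_scope.

(* Sets and classes.  The universe of the carriers of metric spaces plays the
   role of the universe of sets; a class is a predicate on the (large) type of
   metric spaces.  Classes are not written [set (metricType R)], because the
   library puts the universe of [set] strictly below that of [metricType R]. *)
Notation SetType := Type@{Metric.axioms_.u0} (only parsing).

Section MetricSpaces.
Context {R : realType}.

Record is_distance (T : Type) (d : T -> T -> R) : Prop := IsDistance {
  dist_refl : forall x, d x x = 0 ;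
  dist_positivity : forall x y, d x y = 0 -> x = y ;
  dist_symmetry : forall x y, d x y = d y x ;
  dist_triangle : forall y x z, d x z <= d x y + d y z
}.

Definition metric_of (T : Type) (d : T -> T -> R) of is_distance d : Type := T.

HB.instance Definition _ T d (h : @is_distance T d) :=
  gen_eqMixin (metric_of h).
HB.instance Definition _ T d (h : @is_distance T d) :=
  gen_choiceMixin (metric_of h).
HB.instance Definition _ T d (h : @is_distance T d) :=
  @isMetric.Build R (metric_of h) d (dist_refl h) (dist_positivity h)
    (dist_symmetry h) (dist_triangle h).

Definition isometric (X Y : metricType R) : Prop :=
  exists f : X -> Y,
    bijective f /\ forall x x', mdist (f x) (f x') = mdist x x'.

(* Isometry classes are handled through representatives: all the classes below
   are closed under [isometric]. *)
Definition class := metricType R -> Prop.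

Definition GH : class := fun X => inhabited X.

(* By replacement, a class of isometry classes is a set iff its members are the
   values, up to isometry, of a family indexed by a set. *)
Definition is_set (C : class) : Prop :=
  exists (I : SetType) (F : I -> metricType R),
    forall W, C W <-> exists i, isometric W (F i).

Definition proper_class (C : class) : Prop := ~ is_set C.

Definition correspondence (X Y : metricType R) (S : set (X * Y)) : Prop :=
  fst @` S = [set: X] /\ snd @` S = [set: Y].

Definition distortion (X Y : metricType R) (S : set (X * Y)) : \bar R :=
  ereal_sup [set `|mdist p.1 q.1 - mdist p.2 q.2|%:E | p in S & q in S].

Definition d_GH (X Y : metricType R) : \bar R :=
  ((2^-1)%:E *
   ereal_inf [set distortion S | S in @correspondence X Y])%E.

Definition segment (X Y : metricType R) : class :=
  fun W => GH W /\ (d_GH X W + d_GH W Y = d_GH X Y)%E.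

Definition continuous_curve (a b : R) (c : R -> metricType R) : Prop :=
  forall t, t \in `[a, b] ->
    d_GH (c t) (c s) @[s --> within `[a, b] (nbhs t)] --> 0%E.

(* [itv_partition a b s]: the sequence a :: s is strictly increasing and its
   last element is b. *)
Definition curve_length (a b : R) (c : R -> metricType R) : \bar R :=
  ereal_sup [set (\sum_(0 <= i < size s)
                    d_GH (c (nth b (a :: s) i)) (c (nth b s i)))%E
            | s in itv_partition a b].

(* Only the values of the curve on [a, b] matter. *)
Definition shortest_curve (a b : R) (c : R -> metricType R) : Prop :=
  [/\ forall t, t \in `[a, b] -> GH (c t),
      continuous_curve a b c &
      curve_length a b c = d_GH (c a) (c b)].

Definition scale_dist (l : {posnum R}) (X : metricType R) (x y : X) : R :=
  l%:num * mdist x y.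

Lemma scale_distP (l : {posnum R}) (X : metricType R) :
  is_distance (@scale_dist l X).
Proof.
split=> [x|x y|x y|y x z]; rewrite /scale_dist.
- by rewrite mdistxx mulr0.
- by move/eqP; rewrite mulf_eq0 gt_eqF//= => /eqP/mdist_positivity.
- by rewrite metric_sym.
- by rewrite -mulrDr ler_wpM2l// metric_triangle.
Qed.

Definition scale (l : {posnum R}) (X : metricType R) : metricType R :=
  metric_of (scale_distP l X).

Definition simplex_dist (N : Type) (x y : N) : R := if `[< x = y >] then 0 else 1.

Lemma simplex_distP (N : Type) : is_distance (@simplex_dist N).
Proof.
split=> [x|x y|x y|y x z]; rewrite /simplex_dist.
- by case: asboolP.
- by case: asboolP => // _ /eqP; rewrite oner_eq0.
- by congr (if _ then _ else _); apply: asbool_equiv_eq; split.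
- case: (asboolP (x = z)) => xz; case: (asboolP (x = y)) => xy;
    case: (asboolP (y = z)) => yz; try lra.
  by case: xz; rewrite xy.
Qed.

(* The space with a point for each element of N, all of whose non-zero
   distances are 1; N may be infinite. *)
Definition simplex (N : Type) : metricType R := metric_of (simplex_distP N).

Definition simplex_curve (N : Type) (t : R) : metricType R :=
  if pselect (0 < t) is left t0 then scale (PosNum t0) (simplex N)
  else simplex unit.

Definition half_simplex (N : Type) : metricType R :=
  scale (2^-1)%:pos (simplex N).

Section ReplacePoint.
Variables (N : Type) (z : half_simplex N) (A : Type) (e : R).

Definition replace_dist (x y : {x : half_simplex N | x <> z} + A) : R :=
  match x, y with
  | inl x, inl y => mdist (sval x) (sval y)
  | inl x, inr _ => mdist (sval x) z
  | inr _, inl y => mdist z (sval y)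
  | inr a, inr b => if `[< a = b >] then 0 else e
  end.

Lemma half_simplex_dist (x y : half_simplex N) :
  mdist x y = if `[< x = y >] then 0 else 2^-1.
Proof.
rewrite /mdist/= /scale_dist/= /mdist/= /simplex_dist.
by case: ifP; rewrite ?mulr0 ?mulr1.
Qed.

Lemma replace_distP : 0 < e -> e < 2^-1 -> is_distance replace_dist.
Proof.
move=> e0 e1; split.
- by case=> [x|a] /=; [exact: mdistxx | case: asboolP].
- case=> [[x xz]|a] [[y yz]|b] //=.
  + by move/mdist_positivity => xy; congr inl; exact: eq_exist.
  + by move/mdist_positivity.
  + by move/mdist_positivity/esym.
  + by case: asboolP => [->|_] // /eqP; rewrite gt_eqF.
- case=> [x|a] [y|b] /=; try exact: metric_sym.
  by congr (if _ then _ else _); apply: asbool_equiv_eq; split.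
- case=> [[y yz]|b] [[x xz]|a] [[w wz]|c] /=; rewrite ?half_simplex_dist;
    repeat (case: asboolP => ?); subst; try lra; by [].
Qed.

(* half_simplex N with the point z replaced by A. *)
Definition replace_point (e0 : 0 < e) (e1 : e < 2^-1) : metricType R :=
  metric_of (replace_distP e0 e1).

End ReplacePoint.

End MetricSpaces.

Arguments class : clear implicits.
Arguments GH : clear implicits.
Arguments simplex : clear implicits.
Arguments simplex_curve : clear implicits.
Arguments half_simplex : clear implicits.
Arguments replace_point {R N} z A {e} e0 e1.

(* Main.v *)
Require Import Defs.
From HB Require Import structures.
From mathcomp Require Import all_boot all_order all_algebra.
From mathcomp Require Import all_classical all_reals all_analysis.
From mathcomp Require Import lra.

Set Implicit Arguments.
Unset Strict Implicit.
Unset Printing Implicit Defensive.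

Import Order.TTheory GRing.Theory Num.Theory.
Import numFieldNormedType.Exports.

Local Open Scope classical_set_scope.
Local Open Scope ring_scope.

(** Spaces whose diameters s and t are attained are at distance at least |s - t|/2,
    and a surjection with distortion at most |s - t| shows that this bound is
    sharp. Every distance in the theorem is of this kind, with diameters t for
    the point of the curve at time t and 1/2 for both Z and Z'; the lengths of
    inscribed polygons then telescope. A segment (or GH) which were the range
    of a set-indexed family F would contain a space into which all subsets of
    the disjoint union of F inject, against Cantor's theorem. *)

Section GromovHausdorff.
Context {R : realType}.
Implicit Types X Y : metricType R.

(** * Gromov-Hausdorff distance and attained diameters *)

Lemma d_GH_sym X Y : d_GH X Y = d_GH Y X.
Proof.
suff le_swap (V W : metricType R) : (d_GH V W <= d_GH W V)%E.
  by apply/eqP; rewrite eq_le !le_swap.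
rewrite /d_GH lee_pmul2l//; apply: le_ereal_inf_tmp => _ [S [S1 S2] <-].
apply: ge_ereal_inf; exists (distortion [set p : V * W | S (p.2, p.1)]).
  exists [set p : V * W | S (p.2, p.1)] => //; split; apply/seteqP; split => // x _.
    by have /= [[w v] Sp /= <-] : (snd @` S) x by [rewrite S2]; exists (v, w).
  by have /= [[w v] Sp /= <-] : (fst @` S) x by [rewrite S1]; exists (v, w).
apply: ge_ereal_sup => _ [[v w] /= Sp [[v' w'] /= Sq <-]].
apply: ereal_sup_ubound; exists (w, v) => //; exists (w', v') => //=.
by rewrite distrC.
Qed.

(** The diameter is attained, so that a pair realizing it can be followed through a correspondence;
    in particular [X] is non-empty. *)
Definition has_diam X (s : R) : Prop :=
  (forall x x' : X, mdist x x' <= s) /\ exists x x' : X, mdist x x' = s.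

(** Any correspondence relates a pair realizing the larger diameter to a pair whose distance is at
    most the smaller one, so its distortion is at least [|s - t|]. *)
Lemma d_GH_ge_diam X Y (s t : R) : has_diam X s -> has_diam Y t ->
  ((2^-1 * `|s - t|)%:E <= d_GH X Y)%E.
Proof.
move=> [Xs [x [x' xx']]] [Yt [y [y' yy']]].
rewrite /d_GH EFinM lee_pmul2l//; apply: le_ereal_inf_tmp => _ [S [S1 S2] <-].
have [|ts] := leP s t.
- have [/= [v w] Sp /= wy] : (snd @` S) y by rewrite S2.
  have [/= [v' w'] Sq /= wy'] : (snd @` S) y' by rewrite S2.
  move=> st; apply: (@le_trans _ _ (`|mdist v v' - mdist w w'|)%:E).
    rewrite lee_fin wy wy' yy'; have := Xs v v' => vs.
    by rewrite !ler0_norm ?subr_le0//; lra.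
  by apply: ereal_sup_ubound; exists (v, w) => //; exists (v', w').
- have [/= [v w] Sp /= vx] : (fst @` S) x by rewrite S1.
  have [/= [v' w'] Sq /= vx'] : (fst @` S) x' by rewrite S1.
  apply: (@le_trans _ _ (`|mdist v v' - mdist w w'|)%:E).
    rewrite lee_fin vx vx' xx'; have := Yt w w' => wt.
    by rewrite !ger0_norm ?subr_ge0//; lra.
  by apply: ereal_sup_ubound; exists (v, w) => //; exists (v', w').
Qed.

(** The graph of a surjection is a correspondence. *)
Lemma d_GH_le_surj X Y (f : X -> Y) (r : R) : (forall y, exists x, f x = y) ->
  (forall x x', `|mdist x x' - mdist (f x) (f x')| <= r) ->
  (d_GH X Y <= (2^-1 * r)%:E)%E.
Proof.
move=> fsurj fr; rewrite /d_GH EFinM lee_pmul2l//.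
apply: ge_ereal_inf; exists (distortion [set p : X * Y | p.2 = f p.1]).
  exists [set p : X * Y | p.2 = f p.1] => //; split; apply/seteqP; split => // x _.
    by exists (x, f x).
  by have [v vx] := fsurj x; exists (v, x).
by apply: ge_ereal_sup => _ [[v w] /= -> [[v' w'] /= -> <-]]; rewrite lee_fin.
Qed.

Lemma d_GH_surj X Y (f : X -> Y) (s t : R) : has_diam X s -> has_diam Y t ->
  (forall y, exists x, f x = y) ->
  (forall x x', `|mdist x x' - mdist (f x) (f x')| <= `|s - t|) ->
  d_GH X Y = (2^-1 * `|s - t|)%:E.
Proof.
move=> Xs Yt fsurj fr; apply/eqP.
by rewrite eq_le d_GH_ge_diam// (d_GH_le_surj fsurj fr).
Qed.

Lemma simplex_mdist (N : Type) (x y : simplex R N) :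
  mdist x y = if `[< x = y >] then 0 else 1.
Proof. by []. Qed.

Lemma scale_mdist (l : {posnum R}) X (x y : X) :
  mdist (x : scale l X) y = l%:num * mdist x y.
Proof. by []. Qed.

Lemma has_diam_simplex_unit : has_diam (simplex R unit) 0.
Proof. by split=> [[] []|]; rewrite ?mdistxx//; exists tt, tt; rewrite mdistxx. Qed.

Lemma d_GH_point X (s : R) : has_diam X s ->
  d_GH X (simplex R unit) = (2^-1 * s)%:E.
Proof.
move=> Xs; have [Xle [x [x' xx']]] := Xs.
have s0 : 0 <= s by rewrite -xx' mdist_ge0.
rewrite (@d_GH_surj X (simplex R unit) (fun=> tt) s 0 Xs has_diam_simplex_unit).
- by rewrite subr0 ger0_norm.
- by case; exists x.
- by move=> v v'; rewrite mdistxx !subr0 !ger0_norm ?mdist_ge0.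
Qed.

(** * The curve of scaled simplices *)

Section Simplex.
Variable N : Type.
Hypothesis hN : exists x y : N, x <> y.

Lemma has_diam_scale_simplex (l : {posnum R}) :
  has_diam (scale l (simplex R N)) l%:num.
Proof.
split=> [x x'|]; first rewrite scale_mdist simplex_mdist.
  by case: asboolP => _; rewrite ?mulr0 ?mulr1.
have [x [y xy]] := hN; exists x, y; rewrite scale_mdist simplex_mdist.
by case: asboolP => // _; rewrite mulr1.
Qed.

Lemma has_diam_simplex : has_diam (simplex R N) 1.
Proof.
split=> [x x'|]; first by rewrite simplex_mdist; case: asboolP.
by have [x [y xy]] := hN; exists x, y; rewrite simplex_mdist; case: asboolP.
Qed.

Lemma simplex_curve0 : simplex_curve R N 0 = simplex R unit.
Proof. by rewrite /simplex_curve; case: pselect => // t0; exfalso; rewrite ltxx in t0. Qed.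

Lemma simplex_curve_gt0 (t : R) (t0 : 0 < t) :
  simplex_curve R N t = scale (PosNum t0) (simplex R N).
Proof.
rewrite /simplex_curve; case: pselect => // t0'.
by rewrite (Prop_irrelevance t0' t0).
Qed.

Lemma isometric_simplex_curve1 : isometric (simplex_curve R N 1) (simplex R N).
Proof.
rewrite (simplex_curve_gt0 ltr01).
exists id; split; first by exists id.
by move=> x x'; rewrite (@scale_mdist (PosNum ltr01)) mul1r.
Qed.

Lemma has_diam_simplex_curve (t : R) : 0 <= t -> has_diam (simplex_curve R N t) t.
Proof.
rewrite le_eqVlt => /predU1P[<-|t0].
  by rewrite simplex_curve0; exact: has_diam_simplex_unit.
by rewrite (simplex_curve_gt0 t0); exact: has_diam_scale_simplex.
Qed.

Lemma d_GH_simplex_curve (s t : R) : 0 <= s -> 0 <= t ->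
  d_GH (simplex_curve R N s) (simplex_curve R N t) = (2^-1 * `|s - t|)%:E.
Proof.
wlog ts : s t / t <= s => [wlg s0 t0|].
  have [/wlg|/ltW/wlg] := leP t s; first exact.
  by rewrite d_GH_sym distrC; exact.
(* At parameter 0 the carrier collapses to a point and the constant map is used; between positive
   parameters the identity of [N] is optimal. *)
move=> s0; rewrite le_eqVlt => /predU1P[<-|t0].
  rewrite simplex_curve0 subr0 ger0_norm//.
  exact/d_GH_point/has_diam_simplex_curve.
have s1 := lt_le_trans t0 ts.
rewrite (simplex_curve_gt0 t0) (simplex_curve_gt0 s1).
apply: (@d_GH_surj (scale (PosNum s1) (simplex R N))
  (scale (PosNum t0) (simplex R N)) id).
- exact: has_diam_scale_simplex.
- exact: has_diam_scale_simplex.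
- by move=> y; exists y.
- move=> x x'; rewrite 2!scale_mdist simplex_mdist/=.
  by case: asboolP => _; rewrite ?mulr0 ?subrr ?normr0// !mulr1.
Qed.

Lemma simplex_curve_continuous : continuous_curve 0 1 (simplex_curve R N).
Proof.
move=> t; rewrite in_itv/= => /andP[t0 _].
(* On the unit interval the distance between curve points is this real function of [s], which
   vanishes at [t]. *)
have : (2^-1 * `|t - s|)%:E @[s --> within `[0, 1] (nbhs t)] --> 0%E.
  apply: cvg_within_filter; apply: cvg_EFin; first exact: nearW.
  rewrite [X in _ --> X](_ : _ = 2^-1 * `|t - t|); last by rewrite subrr normr0 mulr0.
  apply: cvgMl_tmp; apply: cvg_norm; apply: cvgB; [exact: cvg_cst|exact: cvg_id].
apply: cvg_trans; apply: near_eq_cvg.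
rewrite near_withinE; apply: nearW => s /=; rewrite in_itv/= => /andP[s0 _].
by rewrite d_GH_simplex_curve.
Qed.

(** Each term is half an increment of the parameter, so the sum telescopes. The default of [nth] is
    never reached; [last a s] is chosen to agree with the endpoint used in [curve_length] and to be
    stable under the induction. *)
Lemma sum_d_GH_simplex_curve (a : R) (s : seq R) :
  0 <= a -> path <%R a s ->
  (\sum_(0 <= i < size s) d_GH (simplex_curve R N (nth (last a s) (a :: s) i))
                               (simplex_curve R N (nth (last a s) s i)))%E
  = (2^-1 * (last a s - a))%:E.
Proof.
elim: s a => [|x s IH] a a0 /=; first by rewrite big_nil subrr mulr0.
move=> /andP[ax xs]; have x0 := le_trans a0 (ltW ax).
rewrite big_nat_recl//= IH// d_GH_simplex_curve// -EFinD.
by congr (_%:E); rewrite ltr0_norm ?subr_lt0//; lra.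
Qed.

Lemma length_simplex_curve : curve_length 0 1 (simplex_curve R N) = (2^-1)%:E.
Proof.
(* All inscribed polygons have the same length; the trivial partition shows that there is one. *)
rewrite /curve_length (_ : [set _ | _ in _] = [set (2^-1)%:E]) ?ereal_sup1//.
apply/seteqP; split => [_ [s [s0 /eqP s1] <-]|_ ->] /=.
  by have := sum_d_GH_simplex_curve (lexx 0) s0; rewrite s1 subr0 mulr1.
exists [:: 1]; first exact: itv_partition1.
by rewrite /= big_nat1/= d_GH_simplex_curve// sub0r normrN1 mulr1.
Qed.

Lemma simplex_curve_shortest : shortest_curve 0 1 (simplex_curve R N).
Proof.
split.
- move=> t; rewrite in_itv/= => /andP[t0 _].
  by have [_ [x _]] := has_diam_simplex_curve t0; split.
- exact: simplex_curve_continuous.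
- by rewrite length_simplex_curve d_GH_simplex_curve// sub0r normrN1 mulr1.
Qed.

(** * Replacing a point of the half-size simplex *)

Lemma exists_neq (z : N) : exists y, y <> z.
Proof.
have [x [y xy]] := hN; have [xz|] := pselect (x = z); last by exists x.
by exists y => yz; apply: xy; rewrite xz yz.
Qed.

Section ReplacePoint.
Variables (z : half_simplex R N) (A : Type) (e : R).
Variables (e0 : 0 < e) (e1 : e < 2^-1) (hA : inhabited A).
Let Z' := replace_point z A e0 e1.

Lemma has_diam_replace_point : has_diam Z' 2^-1.
Proof.
split=> [[[x xz]|a] [[y yz]|b]|].
- by rewrite /mdist/= half_simplex_dist; case: ifP.
- by rewrite /mdist/= half_simplex_dist; case: ifP.
- by rewrite /mdist/= half_simplex_dist; case: ifP.
- by rewrite /mdist/=; case: ifP => // _; exact: ltW.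
(* Distances inside [A] are below 1/2, so the diameter is realized between [A] and another
   vertex. *)
have [y yz] := exists_neq z; have [a] := hA.
exists (inl (exist _ y yz)), (inr a).
by rewrite /mdist/= half_simplex_dist; case: asboolP.
Qed.

(** Collapse [A] back to [z]: distinct points of [A] lose [e < 1/2], all other distinct points gain
    exactly 1/2, which is the difference of the diameters. *)
Lemma d_GH_replace_point_simplex : d_GH Z' (simplex R N) = (2^-1 * 2^-1)%:E.
Proof.
have -> : (2^-1 * 2^-1 : R) = 2^-1 * `|2^-1 - 1|.
  by rewrite ler0_norm; lra.
pose f (x : Z') : simplex R N := match x with inl x => sval x | inr _ => z end.
have half : `|2^-1 - 1| = 2^-1 :> R by rewrite ler0_norm; lra.
apply: (@d_GH_surj Z' (simplex R N) f).
- exact: has_diam_replace_point.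
- exact: has_diam_simplex.
- move=> y; have [yz|yz] := pselect (y = z); last by exists (inl (exist _ y yz)).
  by have [a] := hA; exists (inr a).
rewrite half => -[x|a] [x'|b]; rewrite simplex_mdist /mdist/= ?half_simplex_dist.
1-3: by case: asboolP => _; rewrite ?subrr ?normr0 ?half.
rewrite (asboolT (erefl z)) subr0; case: asboolP => _; first by rewrite normr0.
by rewrite gtr0_norm// ltW.
Qed.

End ReplacePoint.

Lemma d_GH_half_simplex : d_GH (half_simplex R N) (simplex R N) = (2^-1 * 2^-1)%:E.
Proof.
have half : `|2^-1 - 1| = 2^-1 :> R by rewrite ler0_norm; lra.
rewrite -[X in (_ * X)%:E]half.
apply: (@d_GH_surj (half_simplex R N) (simplex R N) id).
- exact: has_diam_scale_simplex.
- exact: has_diam_simplex.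
- by move=> y; exists y.
- move=> x x'; rewrite half_simplex_dist simplex_mdist.
  by case: asboolP => _; rewrite ?subrr ?normr0 ?half.
Qed.

Lemma d_GH_point_simplex : d_GH (simplex R unit) (simplex R N) = (2^-1)%:E.
Proof. by rewrite d_GH_sym (d_GH_point has_diam_simplex) mulr1. Qed.

Lemma segment_replace_point (z : half_simplex R N) (A : Type) (e : R)
    (e0 : 0 < e) (e1 : e < 2^-1) : inhabited A ->
  segment (simplex R unit) (simplex R N) (replace_point z A e0 e1).
Proof.
move=> hA; split; first by have [a] := hA; split; exact: (inr a).
rewrite d_GH_sym (d_GH_point (has_diam_replace_point z e0 e1 hA)).
rewrite (d_GH_replace_point_simplex z e0 e1 hA) d_GH_point_simplex -EFinD.
(* The diameter 1/2 lies midway between 0 and 1: 1/4 + 1/4 = 1/2. *)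
by congr (_%:E); lra.
Qed.

End Simplex.

(** * Cantor's theorem and proper classes *)

Lemma cantor_no_injection (T : Type) (g : (T -> Prop) -> T) : ~ injective g.
Proof.
(* The diagonal predicate: codes of predicates that fail at their own code. *)
move=> ginj; pose D x := exists2 P, g P = x & ~ P x.
have DD : ~ D (g D) by move=> [P /ginj -> nD]; apply: (nD); exists D.
by apply: (DD); exists D.
Qed.

(** Members of unbounded cardinality suffice: the power set of the disjoint union of a family is
    again in [SetType], yet would embed in one of its members. *)
Lemma proper_class_large (C : class R) :
  (forall A : SetType, inhabited A ->
     exists W, C W /\ exists f : A -> W, injective f) ->
  proper_class C.
Proof.
move=> large [I [F FC]]; pose T : SetType := {i : I & F i}.
have [|W [CW [f finj]]] := large (T -> Prop); first by split => _; exact: True.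
have [i [h [hbij _]]] := (FC W).1 CW.
apply: (@cantor_no_injection T (fun P => existT _ i (h (f P)))) => P Q.
move=> PQ; apply/finj/(bij_inj hbij).
(* Equality of dependent pairs transports along a proof of [i = i], trivial by proof irrelevance. *)
by have := projT2_eq PQ; rewrite (Prop_irrelevance (projT1_eq PQ) erefl).
Qed.

Lemma GH_proper : proper_class (GH R).
Proof.
apply: proper_class_large => A [a]; exists (simplex R A).
by split; [split|exists id].
Qed.

Lemma segment_proper (N : SetType) : (exists x y : N, x <> y) ->
  proper_class (segment (simplex R unit) (simplex R N)).
Proof.
move=> hN; apply: proper_class_large => A hA.
have [z _] := hN.
(* Any value strictly between 0 and 1/2 would serve. *)
have e0 : 0 < 4^-1 :> R by lra.
have e1 : 4^-1 < 2^-1 :> R by lra.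
exists (replace_point (z : half_simplex R N) A e0 e1).
split; first exact: segment_replace_point.
by exists inr => a b [].
Qed.

End GromovHausdorff.

Theorem mainTheorem4 (R : realType) (N : SetType)
    (hN : exists x y : N, x <> y) :
  let D1 := simplex R unit in
  let Dn := simplex R N in
  let c := simplex_curve R N in
  let Z := half_simplex R N in
  [/\ (d_GH D1 Dn < +oo)%E,
      [/\ isometric (c 0) D1, isometric (c 1) Dn & shortest_curve 0 1 c],
      forall (z : Z) (A : SetType) (e : R) (e0 : 0 < e) (e1 : e < 2^-1),
        inhabited A ->
        let Z' := replace_point z A e0 e1 in
        [/\ d_GH Z' D1 = d_GH Z D1,
            d_GH Z' Dn = d_GH Z Dn &
            segment D1 Dn Z'],
      proper_class (GH R) &
      proper_class (segment D1 Dn)].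
Proof.
move=> D1 Dn c Z; split.
- by rewrite d_GH_point_simplex// ltry.
- split; last exact: simplex_curve_shortest.
  + rewrite /c simplex_curve0; exists id; split => //; by exists id.
  + exact: isometric_simplex_curve1.
- move=> z A e e0 e1 hA Z'; split.
  + rewrite (d_GH_point (has_diam_replace_point hN z e0 e1 hA)).
    by rewrite (d_GH_point (has_diam_scale_simplex hN _)).
  + by rewrite (d_GH_replace_point_simplex hN z e0 e1 hA) d_GH_half_simplex.
  + exact: segment_replace_point.
- exact: GH_proper.
- exact: segment_proper.
Qed.
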